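(* For $n\ge 8$, $c_1(n,P_2)=3$, where $P_2$ is the $3$-graph with vertex set $\{v_1,\dots,v_5\}$ and edges $\{v_1,v_2,v_3\},\{v_3,v_4,v_5\}$.
   Context: For a $3$-graph $G$, $\delta_1(G)$ is the minimum vertex degree (number of edges containing a vertex). $G$ has an $F$-covering if every vertex lies in a copy of $F$; $c_1(n,F)$ is the maximum of $\delta_1(G)$ over $n$-vertex $3$-graphs $G$ with no $F$-covering. *)

(* Defs.v *)
From HB Require Import structures.
From mathcomp Require Import all_boot.

Set Implicit Arguments.
Unset Strict Implicit.
Unset Printing Implicit Defensive.

Definition uniform3 (V : finType) (E : {set {set V}}) : bool :=
  [forall e in E, #|e| == 3].

Record graph3 (V : finType) : Type := Graph3 {
  edges : {set {set V}};
  edges_uniform3 : uniform3 edges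
}.

HB.instance Definition _ (V : finType) := [isSub for @edges V].
HB.instance Definition _ (V : finType) := [Choice of graph3 V by <:].
HB.instance Definition _ (V : finType) := [Countable of graph3 V by <:].
HB.instance Definition _ (V : finType) := [Finite of graph3 V by <:].

Definition degree (V : finType) (G : graph3 V) (v : V) : nat :=
  #|[set e in edges G | v \in e]|.

(* A degree is at most #|edges G|, so for nonempty V the default value of the
   iterated minimum is absorbed and this is the minimum over all vertices. *)
Definition min_degree (V : finType) (G : graph3 V) : nat :=
  \big[minn/#|edges G|]_(v : V) degree G v.

(* A copy is a not necessarily induced subgraph. *)
Definition is_copy (W V : finType) (F : graph3 W) (G : graph3 V)
    (f : {ffun W -> V}) : bool :=
  injectiveb f && [forall e in edges F, f @: e \in edges G].

Definition has_covering (W V : finType) (F : graph3 W) (G : graph3 V) : bool :=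
  [forall v : V, exists f : {ffun W -> V}, is_copy F G f && (v \in codom f)].

(* The edgeless graph has no F-covering when n > 0 and F has an edge, so the
   maximum is then over a nonempty family and is attained. *)
Definition c1 (n : nat) (W : finType) (F : graph3 W) : nat :=
  \max_(G : graph3 'I_n | ~~ has_covering F G) min_degree G.

(* The vertices v_1, ..., v_5 are represented by 0, ..., 4. *)
Definition P2_edges : {set {set 'I_5}} :=
  let v i : 'I_5 := inord i.-1 in
  [set [set v 1; v 2; v 3]; [set v 3; v 4; v 5]].

Lemma P2_uniform3 : uniform3 P2_edges.
Proof.
apply/forall_inP => e; rewrite !inE.
by case/orP=> /eqP->; rewrite -!setUA !cardsU1 cards1 !inE -!val_eqE /= !inordK.
Qed.

Definition P2 : graph3 'I_5 := Graph3 P2_uniform3.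

(* Main.v *)
Require Import Defs.
From mathcomp Require Import all_boot.

(** Upper bound: a vertex x lies outside every P2 exactly when no edge through x
    meets another edge in a single vertex.  Then the link of x is an
    intersecting family of pairs; with at least four pairs it is a star with
    some centre y.  If {x,y,a}, {x,y,b}, {x,y,c} are edges, any edge through a
    other than {x,y,a} would have to be {a,y,z}, and it meets {x,y,b} or
    {x,y,c} in y alone.  So a has degree one.

    Lower bound: the disjoint union of complete 3-graphs on 4 and on n - 4 >= 4
    vertices has minimum degree at least 3, and the first component is too small
    for P2. *)

Lemma min_degree_le (V : finType) (G : graph3 V) (v : V) :
  min_degree G <= degree G v.
Proof.
rewrite /min_degree; have := mem_index_enum v.
elim: (index_enum V) => //= w s IHs; rewrite inE big_cons => /predU1P[->|/IHs].
  exact: geq_minl.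
exact/leq_trans/geq_minr.
Qed.

(** The vertex [v] is there for the default value [#|edges G|] of the iterated minimum, which is at
    least [degree G v]. *)
Lemma le_min_degree (V : finType) (G : graph3 V) (k : nat) (v : V) :
  (forall w, k <= degree G w) -> k <= min_degree G.
Proof.
move=> kdeg; rewrite /min_degree; elim/big_ind: _ => // [|i j ki kj].
  apply: leq_trans (kdeg v) _; apply: subset_leq_card.
  by apply/subsetP => e; rewrite inE => /andP[].
by rewrite leq_min ki.
Qed.

Lemma card3_pair (V : finType) (e : {set V}) (x y : V) :
  #|e| = 3 -> x \in e -> y \in e -> x != y ->
  exists z, [/\ z != x, z != y & e = [set x; y; z]].
Proof.
move=> e3 xe ye xy.
have ye' : y \in e :\ x by rewrite !inE eq_sym xy.
have /eqP/cards1P[z ez] : #|e :\ x :\ y| = 1.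
  by move: e3; rewrite (cardsD1 x) xe (cardsD1 y) ye' => -[].
have : z \in e :\ x :\ y by rewrite ez set11.
rewrite !inE => /and3P[zy zx _]; exists z; split=> //.
by rewrite -(setD1K xe) -(setD1K ye') ez setUA.
Qed.

Lemma card3_single (V : finType) (e : {set V}) (x : V) :
  #|e| = 3 -> x \in e ->
  exists y z, [/\ y != x, z != x, z != y & e = [set x; y; z]].
Proof.
move=> e3 xe.
have /card_gt0P[y] : 0 < #|e :\ x| by move: e3; rewrite (cardsD1 x) xe add1n => -[->].
rewrite !inE => /andP[yx ye].
have [|z [zx zy ez]] := card3_pair _ _ _ _ e3 xe ye; first by rewrite eq_sym.
by exists y, z.
Qed.

Lemma is_copy_P2 (V : finType) (G : graph3 V) (f : {ffun 'I_5 -> V}) :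
  is_copy P2 G f =
  [&& injectiveb f,
      [set f (inord 0); f (inord 1); f (inord 2)] \in edges G
    & [set f (inord 2); f (inord 3); f (inord 4)] \in edges G].
Proof.
rewrite /is_copy; congr (_ && _).
have imf (i j k : 'I_5) : f @: [set i; j; k] = [set f i; f j; f k].
  by rewrite !imsetU !imset_set1.
apply/forall_inP/andP => [fE|[E1 E2] e].
  by rewrite -!imf; split; apply: fE; rewrite !inE eqxx ?orbT.
by rewrite !inE => /orP[]/eqP->; rewrite imf.
Qed.

(** The shared vertex [u] plays $v_3$; the other two vertices of each edge fill the two ends. *)
Lemma P2_cover (V : finType) (G : graph3 V) (e e' : {set V}) (x u : V) :
  e \in edges G -> e' \in edges G -> x \in e -> e :&: e' = [set u] ->
  exists f : {ffun 'I_5 -> V}, is_copy P2 G f && (x \in codom f).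
Proof.
move=> eG e'G xe ee'.
have [/forall_inP G3] := edges_uniform3 G.
have : u \in e :&: e' by rewrite ee' set11.
rewrite inE => /andP[ue ue'].
have [a [b [au bu ba E]]] := card3_single _ _ _ (eqP (G3 _ eG)) ue.
have [c [d [cu du dc E']]] := card3_single _ _ _ (eqP (G3 _ e'G)) ue'.
have out w : w \in e -> w != u -> w \notin e'.
  by move=> we; apply: contraNN => we'; rewrite -in_set1 -ee' inE we.
have /norP[/norP[ac ad] _] : ~~ [|| (a == c) || (a == d) | a == u].
  have : a \notin e' by rewrite out // E !inE eqxx orbT.
  by rewrite E' !inE; do !case: eqP.
have /norP[/norP[bc bd] _] : ~~ [|| (b == c) || (b == d) | b == u].
  have : b \notin e' by rewrite out // E !inE eqxx orbT.
  by rewrite E' !inE; do !case: eqP.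
(* Index 2 stands for $v_3$, so [u] goes in the middle. *)
pose s := [:: a; b; u; c; d].
have s_uniq : uniq s.
  rewrite /= !inE !negb_or (eq_sym a b) (eq_sym u c) (eq_sym u d) (eq_sym c d).
  by rewrite ba au ac ad bu bc bd cu du dc.
pose f := [ffun i : 'I_5 => nth u s i].
have fE k : k < 5 -> f (inord k) = nth u s k by move=> k5; rewrite ffunE inordK.
exists f; rewrite is_copy_P2 !fE //=; apply/andP; split; last first.
  have fk k : k < 5 -> nth u s k \in codom f.
    by move=> k5; rewrite -fE //; apply: codom_f.
  move: xe; rewrite E !inE => /orP[/orP[]|] /eqP->.
  - exact: (fk 2).
  - exact: (fk 0).
  - exact: (fk 1).
apply/and3P; split.
- apply/injectiveP => i j; rewrite !ffunE => /eqP.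
  by rewrite nth_uniq // => /eqP/val_inj.
- by rewrite setUC setUA -E.
- by rewrite -E'.
Qed.

Lemma P2_covering_of_min_degree (V : finType) (G : graph3 V) :
  3 < min_degree G -> has_covering P2 G.
Proof.
move=> degG; apply/forallP => x; apply: contraT => /existsP uncov.
have deg v : 3 < degree G v := leq_trans degG (min_degree_le _ _ _).
have [/forall_inP G3] := edges_uniform3 G.
(* If [u] were the only common vertex, the two edges would form a $P_2$ covering [x]. *)
have meet e e' u : e \in edges G -> e' \in edges G -> x \in e ->
    u \in e -> u \in e' -> exists w, [/\ w != u, w \in e & w \in e'].
  move=> eG e'G xe ue ue'.
  have [/eqP ee'|] := set_0Vmem ((e :&: e') :\ u); last first.
    by case=> w; rewrite !inE => /and3P[? ? ?]; exists w.
  case: uncov; apply: (P2_cover _ _ _ _ x u eG e'G xe).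
  by rewrite -(@setD1K _ u (e :&: e')) ?inE ?ue // (eqP ee') setU0.
have ex_edge v (S : {set {set V}}) : #|S| < 4 ->
    exists e, [/\ e \in edges G, v \in e & e \notin S].
  move=> S4; have /subsetPn[e] : ~~ ([set e in edges G | v \in e] \subset S).
    by apply: contraL S4 => /subset_leq_card; rewrite -leqNgt; apply/leq_trans/deg.
  by rewrite inE => /andP[eG ve] eS; exists e.
have [e1 [e1G xe1 _]] := ex_edge x set0 ltac:(by rewrite cards0).
have [e2 [e2G xe2 e2S]] := ex_edge x [set e1] ltac:(by rewrite cards1).
have [y [yx ye1 ye2]] := meet _ _ _ e1G e2G xe1 xe1 xe2.
have xy : x != y by rewrite eq_sym.
have [a [ax ay E1]] := card3_pair _ _ _ _ (eqP (G3 _ e1G)) xe1 ye1 xy.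
have [b [bx b_y E2]] := card3_pair _ _ _ _ (eqP (G3 _ e2G)) xe2 ye2 xy.
have ab : a != b by apply: contraNneq e2S => ab; rewrite E2 -ab -E1 set11.
(* Avoiding [[set x; a; b]] rules out a triangle on [y], [a], [b] in the link of [x], the only way
   for the link to fail to be a star at [y]. *)
have [|e3 [e3G xe3 e3S]] := ex_edge x [set e1; e2; [set x; a; b]].
  by rewrite -!setUA !cardsU1 cards1 !addnA addn1 ltnS; do 2?case: (_ \notin _).
move: e3S; rewrite !inE !negb_or -andbA => /and3P[e31 e32 e3ab].
(* Both edges contain [x], so they share a second vertex; it is not [y], hence it is [v]. *)
have link v e e' : e \in edges G -> e = [set x; y; v] -> e' \in edges G ->
    x \in e' -> y \notin e' -> v \in e'.
  move=> eG E e'G xe' ye'.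
  have [|||w [wx we we']] := meet e e' x eG e'G; rewrite ?E ?inE ?eqxx //.
  move: we; rewrite E !inE (negPf wx) => /orP[]/eqP ew; last by rewrite -ew.
  by rewrite -ew we' in ye'.
have ye3 : y \in e3.
  apply: contraNT e3ab => ye3.
  have ae3 := link a e1 e3 e1G E1 e3G xe3 ye3.
  have be3 := link b e2 e3 e2G E2 e3G xe3 ye3.
  rewrite eq_sym eqEcard !subUset !sub1set xe3 ae3 be3 (eqP (G3 _ e3G)).
  by rewrite -setUA !cardsU1 cards1 !inE !(eq_sym x) (negPf ax) (negPf bx) (negPf ab).
have [c [cx cy E3]] := card3_pair _ _ _ _ (eqP (G3 _ e3G)) xe3 ye3 xy.
have ac : a != c by apply: contraNneq e31 => ac; rewrite E3 -ac -E1.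
have bc : b != c by apply: contraNneq e32 => bc; rewrite E3 -bc -E2.
(* A second edge at [a] is refuted according to which of [x] and [y] it contains. *)
have [f [fG af]] := ex_edge a [set e1] ltac:(by rewrite cards1).
rewrite inE => fe1.
have no4 v : v \in f -> b \in f -> c \in f -> v != a -> v != b -> v != c -> False.
  move=> vf bf cf va vb vc.
  have : size [:: v; a; b; c] <= #|f|.
    apply/card_geqP; exists [:: v; a; b; c]; split=> // [|z].
      by rewrite /= !inE !negb_or va vb vc ab ac bc.
    by rewrite !inE => /or4P[]/eqP->.
  by rewrite (eqP (G3 _ fG)).
(* With both, [f] is [e1]. With exactly one, [e2] and [e3] force [b] and [c] into [f], which then
   has four vertices. With neither, [f] meets [e1] in [a] alone. *)
have [xf|xf] := boolP (x \in f); have [yf|yf] := boolP (y \in f).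
- case/negP: fe1; rewrite eq_sym eqEcard (eqP (G3 _ fG)) (eqP (G3 _ e1G)) leqnn.
  by rewrite E1 !subUset !sub1set xf yf af.
- case: (no4 x xf); rewrite 1?eq_sym //.
    exact: link e2G E2 fG xf yf.
  exact: link e3G E3 fG xf yf.
- have out v e : e \in edges G -> e = [set x; y; v] -> v \in f.
    move=> eG E.
    have [|||w [wy we wf]] := meet e f y eG fG; rewrite ?E ?inE ?eqxx ?orbT //.
    move: we; rewrite E !inE (negPf wy) orbF => /orP[]/eqP ew; last by rewrite -ew.
    by rewrite -ew wf in xf.
  by case: (no4 y yf (out b e2 e2G E2) (out c e3 e3G E3)); rewrite 1?eq_sym.
- have [|w [wa we wf]] := meet e1 f a e1G fG xe1 _ af.
    by rewrite E1 !inE eqxx orbT.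
  move: we; rewrite E1 !inE (negPf wa) orbF => /orP[]/eqP ew.
    by rewrite -ew wf in xf.
  by rewrite -ew wf in yf.
Qed.

Definition cliques_edges {V : finType} (A : {set V}) : {set {set V}} :=
  [set e : {set V} | (#|e| == 3) && ((e \subset A) || (e \subset ~: A))].

Lemma cliques_uniform3 {V : finType} (A : {set V}) : uniform3 (cliques_edges A).
Proof. by apply/forall_inP => e; rewrite inE => /andP[]. Qed.

Definition cliques {V : finType} (A : {set V}) : graph3 V :=
  Graph3 (cliques_uniform3 A).

(** Adding [v] to the pairs in [B :\ v] maps them injectively to edges at [v]. *)
Lemma clique_degree (V : finType) (G : graph3 V) (B : {set V}) (v : V) :
  (forall e : {set V}, #|e| = 3 -> e \subset B -> e \in edges G) ->
  v \in B -> 'C(#|B|.-1, 2) <= degree G v.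
Proof.
move=> BG vB; have -> : #|B|.-1 = #|B :\ v| by rewrite [#|B|](cardsD1 v) vB.
rewrite -cards_draws -(@card_in_imset _ _ (setU [set v])) => [|e e'].
  apply/subset_leq_card/subsetP => _ /imsetP[e + ->].
  rewrite !inE subsetD1 => /andP[/andP[eB ve] /eqP e2].
  by rewrite eqxx andbT BG ?cardsU1 ?ve ?e2 // subUset sub1set vB.
rewrite !inE !subsetD1 => /andP[/andP[_ ve] _] /andP[/andP[_ ve'] _] ee'.
by rewrite -(setU1K ve) -(setU1K ve') ee'.
Qed.

Lemma cliques_min_degree (V : finType) (A : {set V}) (v : V) :
  3 < #|A| -> 3 < #|~: A| -> 2 < min_degree (cliques A).
Proof.
move=> A4 A'4; apply: (le_min_degree _ _ _ v) => w.
have bin3 k : 3 < k -> 2 < 'C(k.-1, 2).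
  by case: k => // k k3; apply: (@leq_bin2l 3 k 2).
have [wA|wA] := boolP (w \in A).
  apply: leq_trans (bin3 _ A4) (clique_degree _ _ _ _ _ wA) => e e3 eA.
  by rewrite inE e3 eA.
rewrite -in_setC in wA.
apply: leq_trans (bin3 _ A'4) (clique_degree _ _ _ _ _ wA) => e e3 eA.
by rewrite inE e3 eA orbT.
Qed.

(** Each edge lies on one side of the partition, and the two edges of a $P_2$ share $v_3$, so a
    whole copy lies on one side. A copy through [v] would put five vertices into [A]. *)
Lemma cliques_no_P2_covering (V : finType) (A : {set V}) (v : V) :
  v \in A -> #|A| < 5 -> ~~ has_covering P2 (cliques A).
Proof.
move=> vA A5; apply/negP => /forallP/(_ v)/existsP[f /andP[]].
rewrite is_copy_P2 !inE => /and3P[/injectiveP f_inj /andP[_ E1] /andP[_ E2]].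
case/codomP => j vj.
have same (e : {set V}) y z : (e \subset A) || (e \subset ~: A) ->
    y \in e -> z \in e -> (y \in A) = (z \in A).
  case/orP=> /subsetP eA ye ze; first by rewrite !eA.
  by have := eA y ye; have := eA z ze; rewrite !inE => /negPf-> /negPf->.
have side i : (f i \in A) = (f (inord 2) \in A).
  rewrite -[i]inord_val; case: i => [[|[|[|[|[|//]]]]] _] /=;
    by [apply: same E1 _ _; rewrite !inE eqxx ?orbT
       |apply: same E2 _ _; rewrite !inE eqxx ?orbT].
have fA i : f i \in A by rewrite side -(side j) -vj.
have : #|codom f| <= #|A|.
  by apply/subset_leq_card/subsetP => _ /codomP[i ->].
by rewrite card_codom // card_ord leqNgt A5.
Qed.

Theorem theorem4 (n : nat) (hn : 8 <= n) : c1 n P2 = 3.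
Proof.
have n0 : 0 < n by apply: leq_trans hn.
apply/eqP; rewrite eqn_leq; apply/andP; split.
  apply/bigmax_leqP => G; apply: contraR; rewrite -ltnNge.
  exact: P2_covering_of_min_degree.
(* Four is the largest size too small for a $P_2$ and the smallest giving degree ['C(3, 2)] = 3;
   [hn] leaves at least four vertices outside. *)
pose A := [set i : 'I_n | i < 4].
have cA : #|A| = 4.
  by rewrite -sum1dep_card (big_ord_narrow (leq_trans _ hn)) // sum1_card card_ord.
have vA : Ordinal n0 \in A by rewrite inE.
apply: (bigmax_sup (cliques A)).
  by apply: cliques_no_P2_covering vA _; rewrite cA.
apply: (cliques_min_degree _ _ (Ordinal n0)); first by rewrite cA.
by move: hn; rewrite -[n in _ <= n]card_ord -(cardsC A) cA (leq_add2l 4 4).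
Qed.
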